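(* Let $AP$ be a set of atomic propositions and $Ag$ a finite set of agents. Global and local announcement logic (GLAL), with language $\mathcal{L}_{glal}$, is strictly more expressive than epistemic logic with common knowledge, with language $\mathcal{L}_{el}$. That is: (1) every formula of $\mathcal{L}_{el}$ is equivalent to some formula of $\mathcal{L}_{glal}$; and (2) there is a formula of $\mathcal{L}_{glal}$ that is not equivalent to any formula of $\mathcal{L}_{el}$. Here two formulas are equivalent if they are satisfied at exactly the same pointed models $(\mathcal{M},w)$.
   Context: Language. $AP$ is a set of atoms and $Ag$ a finite set of agents. The formulas of $\mathcal{L}_{glal}$ are given, for $p\in AP$ and $A\subseteq Ag$, by $\psi ::= p \mid \neg\psi \mid \psi\land\psi \mid C_A\psi \mid [\psi]^+_A\psi \mid [\psi]^-_A\psi$. The fragment $\mathcal{L}_{el}$ is obtained by dropping the clauses $[\psi]^+_A\psi$ and $[\psi]^-_A\psi$. Other Boolean connectives are defined as usual. Models. A (Kripke) model is $\mathcal{M}=\langle W,\{R_a\}_{a\in Ag},V\rangle$ with $W$ a set of worlds, each $R_a$ an equivalence relation on $W$, and $V:AP\to 2^W$. A pointed model is a pair $(\mathcal{M},w)$ with $w\in W$. For $w\in W$, $R_a(w)=\{w' : R_a(w,w')\}$; for $A\subseteq Ag$, $R^C_A=(\bigcup_{a\in A}R_a)^*$ is the reflexive and transitive closure of the union, and $R^C_A(w)=\{w' : R^C_A(w,w')\}$. Semantics. The satisfaction set $[\![\varphi]\!]_{\mathcal{M}}\subseteq W$ is defined by: $[\![p]\!]_{\mathcal{M}}=V(p)$;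 $[\![\neg\psi]\!]_{\mathcal{M}}=W\setminus[\![\psi]\!]_{\mathcal{M}}$; $[\![\psi\land\psi']\!]_{\mathcal{M}}=[\![\psi]\!]_{\mathcal{M}}\cap[\![\psi']\!]_{\mathcal{M}}$; $[\![C_A\psi]\!]_{\mathcal{M}}=\{w : R^C_A(w)\subseteq[\![\psi]\!]_{\mathcal{M}}\}$; and for $\star\in\{+,-\}$, $[\![[\psi]^\star_A\psi']\!]_{\mathcal{M}}=\{w : \text{if } w\in[\![\psi]\!]_{\mathcal{M}} \text{ then } w\in[\![\psi']\!]_{\mathcal{M}^\star_{(w,\psi,A)}}\}$. The refinements $\mathcal{M}^-_{(w,\psi,A)}$ and $\mathcal{M}^+_{(w,\psi,A)}$ have the same worlds and valuation as $\mathcal{M}$ and relations $R^-_b=R^+_b=R_b$ for $b\notin A$, while for $a\in A$: $R^-_a(v)=R_a(v)\cap[\![\psi]\!]_{\mathcal{M}}$ if $v\in R_a(w)\cap[\![\psi]\!]_{\mathcal{M}}$; $R^-_a(v)=R_a(v)\cap[\![\neg\psi]\!]_{\mathcal{M}}$ if $v\in R_a(w)\cap[\![\neg\psi]\!]_{\mathcal{M}}$; $R^-_a(v)=R_a(v)$ otherwise; and $R^+_a(v)$ is defined by the same three cases with $R_a(w)$ replaced by $R^C_A(w)$ in the case conditions. We write $(\mathcal{M},w)\models\varphi$ (''$\varphi$ is satisfied at $(\mathcal{M},w)$'') for $w\in[\![\varphi]\!]_{\mathcal{M}}$.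
   Formalization: Part (2) is stated for a nonempty set of atomic propositions and at least two agents; with no atoms there are no formulas, and with at most one agent the announcement operators reduce to epistemic formulas, so (2) is false in those cases. *)

(* Defs.v *)
From mathcomp Require Import all_boot.
From mathcomp Require Import boolp classical_sets.
From Stdlib Require Import Relations RelationClasses.

Set Implicit Arguments.
Unset Strict Implicit.
Unset Printing Implicit Defensive.

Local Open Scope classical_set_scope.

Inductive formula (AP : Type) (Ag : finType) : Type :=
| Atom of AP
| Neg of formula AP Ag
| Conj of formula AP Ag & formula AP Ag
| Common of {set Ag} & formula AP Ag                       (* C_A psi *)
| GlobalAnn of {set Ag} & formula AP Ag & formula AP Ag   (* [psi]^+_A chi *)
| LocalAnn of {set Ag} & formula AP Ag & formula AP Ag.   (* [psi]^-_A chi *)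

Arguments Atom {AP Ag}.

Fixpoint in_el AP Ag (phi : formula AP Ag) : bool :=
  match phi with
  | Atom _ => true
  | Neg psi => in_el psi
  | Conj psi chi => in_el psi && in_el chi
  | Common _ psi => in_el psi
  | GlobalAnn _ _ _ => false
  | LocalAnn _ _ _ => false
  end.

(** [acc a v] is the set R_a(v), i.e. [acc a v u] reads R_a(v, u). *)
Record model (AP : Type) (Ag : finType) : Type := Model {
  world :> Type;
  acc : Ag -> world -> set world;
  acc_equiv : forall a, Equivalence (acc a);
  val : AP -> set world
}.

Definition relC AP Ag (M : model AP Ag) (A : {set Ag}) : M -> set M :=
  clos_refl_trans M (fun v u => exists2 a, a \in A & acc a v u).

(** The three-case refinement of one relation [R] by the set [S]; [D] is the
    region in which the cut takes place: R_a(w) for the local announcement,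
    R^C_A(w) for the global one. *)
Definition cut (W : Type) (D S : set W) (R : W -> set W) (v : W) : set W :=
  if `[< (D `&` S) v >] then R v `&` S
  else if `[< (D `&` ~` S) v >] then R v `&` ~` S
  else R v.

Lemma cut_equiv (W : Type) (D S : set W) (R : W -> set W) :
  Equivalence R -> (forall v u, R v u -> D v -> D u) -> Equivalence (cut D S R).
Proof.
move=> [Rr Rs Rt] DR.
have cutE v u : cut D S R v u <-> R v u /\ (D v -> (S v <-> S u)).
  rewrite /cut; case: asboolP => [[Dv Sv]|nDS].
    by split=> [[]|[Rvu /(_ Dv) h]]; [|split=> //; apply/h].
  case: asboolP => [[Dv Sv]|nDnS].
    by split=> [[Rvu Su]|[Rvu /(_ Dv) h]]; split=> // /h.
  split=> [Rvu|[]//]; split=> // Dv.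
  by have [Sv|Sv] := pselect (S v); [case: nDS|case: nDnS].
split=> [v|v u|v u t]; rewrite ?cutE.
- by split; first exact: Rr.
- move=> [Rvu h]; split=> [|Du]; first exact: Rs.
  by have [] := h (DR _ _ (Rs _ _ Rvu) Du).
- move=> [Rvu h] [Rut k]; split=> [|Dv]; first exact: Rt Rvu Rut.
  by have [] := h Dv; have [] := k (DR _ _ Rvu Dv); tauto.
Qed.

Definition local_rel AP Ag (M : model AP Ag) (w : M) (S : set M)
    (A : {set Ag}) (b : Ag) : M -> set M :=
  if b \in A then cut (acc b w) S (acc b) else acc b.

Definition global_rel AP Ag (M : model AP Ag) (w : M) (S : set M)
    (A : {set Ag}) (b : Ag) : M -> set M :=
  if b \in A then cut (relC A w) S (acc b) else acc b.

Lemma local_rel_equiv AP Ag (M : model AP Ag) (w : M) (S : set M)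
    (A : {set Ag}) b :
  Equivalence (local_rel w S A b).
Proof.
rewrite /local_rel; case: ifP => _; last exact: acc_equiv.
apply: cut_equiv; first exact: acc_equiv.
by have [_ _ Rt] := @acc_equiv _ _ M b => v u Rvu Rwv; exact: Rt Rwv Rvu.
Qed.

Lemma global_rel_equiv AP Ag (M : model AP Ag) (w : M) (S : set M)
    (A : {set Ag}) b :
  Equivalence (global_rel w S A b).
Proof.
rewrite /global_rel; case: ifP => [bA|_]; last exact: acc_equiv.
apply: cut_equiv; first exact: acc_equiv.
by move=> v u Rvu Rwv; apply: rt_trans Rwv _; apply: rt_step; exists b.
Qed.

(** M^-_(w, psi, A) and M^+_(w, psi, A), where [S] is the satisfaction set of
    psi in [M]. *)
Definition local_refine AP Ag (M : model AP Ag) (w : M) (S : set M)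
    (A : {set Ag}) : model AP Ag :=
  Model (local_rel_equiv w S A) (@val _ _ M).

Definition global_refine AP Ag (M : model AP Ag) (w : M) (S : set M)
    (A : {set Ag}) : model AP Ag :=
  Model (global_rel_equiv w S A) (@val _ _ M).

Unset Implicit Arguments.

Fixpoint sat {AP Ag} (phi : formula AP Ag) (M : model AP Ag) : set M :=
  match phi with
  | Atom p => val p
  | Neg psi => ~` sat psi M
  | Conj psi chi => sat psi M `&` sat chi M
  | Common A psi => [set w | relC A w `<=` sat psi M]
  | GlobalAnn A psi chi =>
      [set w | sat psi M w -> sat chi (global_refine w (sat psi M) A) w]
  | LocalAnn A psi chi =>
      [set w | sat psi M w -> sat chi (local_refine w (sat psi M) A) w]
  end.

Definition equivalent {AP Ag} (phi psi : formula AP Ag) : Prop :=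
  forall (M : model AP Ag) (w : M), sat phi M w <-> sat psi M w.

(* Main.v *)
(** Formulas of epistemic logic with common knowledge are invariant under
    bounded morphisms, but the local announcement is not: it cuts the relation
    of [a] only in the [a]-class of the current world, and leaves untouched a
    copy of that class which another agent [b] can reach. So [b] can tell, after
    the announcement, whether there is only one copy of the two-world model in
    which [a] is ignorant of [p], or several copies linked by [b]. *)
Require Import Defs.
From mathcomp Require Import all_boot.
From mathcomp Require Import boolp classical_sets.
From Stdlib Require Import Relations RelationClasses.

Set Implicit Arguments.
Unset Strict Implicit.
Unset Printing Implicit Defensive.

Local Open Scope classical_set_scope.

Section BoundedMorphism.
Variables (AP : Type) (Ag : finType) (M N : model AP Ag) (f : M -> N).
Hypothesis f_val : forall p v, Defs.val p v <-> Defs.val p (f v).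
Hypothesis f_forth : forall a v u, acc a v u -> acc a (f v) (f u).
Hypothesis f_back :
  forall a v y, acc a (f v) y -> exists2 u, acc a v u & f u = y.

Lemma relC_forth (A : {set Ag}) v u : relC A v u -> relC A (f v) (f u).
Proof.
elim=> [x y [a aA Rxy]|x|x y z _ xy _ yz].
- by apply: rt_step; exists a => //; exact: f_forth.
- exact: rt_refl.
- exact: rt_trans xy yz.
Qed.

Lemma relC_back (A : {set Ag}) v y :
  relC A (f v) y -> exists2 u, relC A v u & f u = y.
Proof.
move=> Rvy; have [x fvx] : exists x, x = f v by exists (f v).
rewrite -fvx in Rvy; elim: Rvy v fvx => {x y}
  [x y [a aA Rxy]|x|x y z _ IHxy _ IHyz] v xE.
- rewrite xE in Rxy; have [u Rvu <-] := f_back Rxy.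
  by exists u => //; apply: rt_step; exists a.
- by exists v => //; exact: rt_refl.
- have [u Rvu fuy] := IHxy _ xE; have [t Rut ftz] := IHyz _ (esym fuy).
  by exists t => //; exact: rt_trans Rvu Rut.
Qed.

(** Forth and back carry over from each [acc a] to the closure [relC A], which settles the [Common]
    case; [in_el] excludes announcements. *)
Lemma sat_el_morphism (phi : formula AP Ag) v :
  in_el phi -> sat phi M v <-> sat phi N (f v).
Proof.
elim: phi v => //= [psi IH|psi IH1 chi IH2|A psi IH] v.
- by move=> /(IH v); rewrite /setC /=; tauto.
- by move=> /andP[/(IH1 v) h1 /(IH2 v) h2]; rewrite /setI /=; tauto.
- move=> el_psi; split=> h.
    by move=> _ /relC_back[u Rvu <-]; apply/(IH u el_psi)/h.
  by move=> u Rvu; apply/(IH u el_psi)/h/relC_forth.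
Qed.

End BoundedMorphism.

(** Each [acc a] is already reflexive and transitive, so common knowledge of one agent is individual
    knowledge. *)
Lemma relC_set1 AP Ag (M : model AP Ag) (a : Ag) (v u : M) :
  relC [set a]%SET v u <-> acc a v u.
Proof.
have [Rr _ Rt] := @acc_equiv _ _ M a.
split=> [|Rvu]; last by apply: rt_step; exists a; rewrite ?inE.
elim=> [x y [c]|x|x y z _ xy _ yz]; [by rewrite inE => /eqP ->|exact: Rr|].
exact: Rt xy yz.
Qed.

Lemma cut_in (W : Type) (D S : set W) (R : W -> set W) v u :
  D v -> cut D S R v u <-> R v u /\ (S v <-> S u).
Proof.
move=> Dv; rewrite /cut /setI /setC /=.
case: asboolP => [[_ Sv]|nDS] /=; first by tauto.
by case: asboolP => nDnS /=; tauto.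
Qed.

Lemma cut_out (W : Type) (D S : set W) (R : W -> set W) v :
  ~ D v -> cut D S R v = R v.
Proof. by move=> nDv; rewrite /cut; do 2![case: asboolP => [[]//|_]]. Qed.

Section Copies.
Variables (AP : Type) (Ag : finType) (a b : Ag) (p : AP).
Hypothesis ab : a != b.

(** The boolean will be the truth value of the atoms, the index names the copy. The classes of [a]
    are the copies; any other agent has the total relation. *)
Definition copies_acc (I : Type) (c : Ag) (v : bool * I) : set (bool * I) :=
  [set u | c = a -> v.2 = u.2].

Lemma copies_acc_equiv I c : Equivalence (@copies_acc I c).
Proof.
split=> [v //|v u h ca|v u t h k ca]; first by rewrite h.
by rewrite h ?k.
Qed.

(* All atoms share a valuation: equality on [AP] need not be decidable. *)
Definition copies (I : Type) : model AP Ag :=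
  Model (@copies_acc_equiv I) (fun=> [set v : bool * I | v.1]).

Lemma sat_el_copies I (i : I) x (phi : formula AP Ag) :
  in_el phi -> sat phi (copies I) (x, i) <-> sat phi (copies unit) (x, tt).
Proof.
apply: (@sat_el_morphism _ _ (copies I) (copies unit) (fun v => (v.1, tt)))
  => // c v [y []] _.
(* Staying in the copy of [v] makes the lift a successor for [a] as well. *)
by exists (y, v.2).
Qed.

Definition knows_whether (c : Ag) (q : formula AP Ag) : formula AP Ag :=
  Neg (Conj (Neg (Common [set c]%SET q)) (Neg (Common [set c]%SET (Neg q)))).

Definition single_copy : formula AP Ag :=
  LocalAnn [set a]%SET (Atom p)
    (Common [set b]%SET (knows_whether a (Atom p))).

Lemma sat_single_copy I (i : I) :
  sat single_copy (copies I) (true, i) <-> forall j, j = i.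
Proof.
pose N := @local_refine _ _ (copies I) (true, i) (Defs.val p) [set a]%SET.
change ((true -> @relC _ _ N [set b]%SET (true, i) `<=`
  sat (knows_whether a (Atom p)) N) <-> forall j, j = i).
have accb v u : @acc _ _ N b v u.
  by rewrite /= /local_rel inE eq_sym (negPf ab) => ba; case/eqP: ab.
have acca : @acc _ _ N a =
    @cut (copies I) (copies_acc a (true, i)) (Defs.val p) (@copies_acc I a).
  by rewrite /= /local_rel inE eqxx.
split=> [/(_ isT) h j|allI _ v _ [nK nKn]].
  apply: contrapT => ji.
  (* Copy [j] lies outside the cut, so its two worlds, which disagree on [p], stay linked for [a]:
     at [(false, j)], within reach of [b], [a] is ignorant. *)
  have nD x : ~ copies_acc a (true, i) (x, j) by move=> /(_ erefl) /esym.
  have /relC_set1/h := accb (true, i) (false, j); apply; split=> K.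
    suff /relC_set1/K : @acc _ _ N a (false, j) (false, j) by [].
    by rewrite acca cut_out.
  suff /relC_set1/K : @acc _ _ N a (false, j) (true, j) by apply.
  by rewrite acca cut_out.
(* With one copy the cut region is everything, so linked worlds of [a] agree on [p]. *)
have Dv : copies_acc a (true, i) v by move=> _; rewrite [RHS]allI.
have [pv|npv] := pselect (v.1).
  by apply: nK => u /relC_set1; rewrite acca => /(cut_in _ _ _ Dv)[_ <-].
by apply: nKn => u /relC_set1; rewrite acca => /(cut_in _ _ _ Dv)[_ /= vu] /vu.
Qed.

End Copies.

Theorem theorem6 (AP : Type) (Ag : finType) :
  (forall phi : formula AP Ag, in_el phi ->
     exists psi : formula AP Ag, equivalent phi psi)
  /\
  (inhabited AP -> (1 < #|Ag|)%N ->
     exists psi : formula AP Ag,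
       forall phi : formula AP Ag, in_el phi -> ~ equivalent psi phi).
Proof.
split=> [phi _|[p] /card_gt1P[a [b [_ _ ab]]]]; first by exists phi.
exists (single_copy a b p) => phi el_phi eq_phi.
have one : sat (single_copy a b p) (copies AP a unit) (true, tt).
  by apply/(sat_single_copy _ ab) => -[].
(* As [phi] cannot tell one copy from two, truth passes to the model indexed by [bool], forcing
   [false = true]. *)
move: one => /eq_phi /(sat_el_copies a true true el_phi) /eq_phi.
by move=> /(sat_single_copy _ ab) /(_ false).
Qed.
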